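(* Let $Q_8$ be the quaternion group of order $8$. Then $\mathsf{Ca}(Q_8)=[2,4]$, $\daleth^{*}(Q_8)=[3,4]$, and $\Delta(Q_8)=[1,2]$.
   Context: Here $[a,b]=\{x\in\mathbb Z : a\le x\le b\}$. Let $G$ be a finite group, written multiplicatively, with identity $1_G$. Sequences. A sequence over $G$ is a finite collection $S=g_1\cdot\ldots\cdot g_\ell$ of elements of $G$, repetition allowed and order disregarded, i.e. an element of the free abelian monoid $\mathcal F(G)$ with basis $G$; the operation $\cdot$ is concatenation of sequences. $S$ is product-one if its terms can be ordered so that their product in $G$ equals $1_G$ (the empty sequence is product-one). $\mathcal B(G)$ is the monoid of all product-one sequences over $G$ under concatenation. $\mathcal A(G)$ is its set of atoms: the non-empty product-one sequences that are not the concatenation of two non-empty product-one sequences. Factorizations. For $S\in\mathcal B(G)$, a factorization of $S$ is an element $z$ of the free abelian monoid with basis $\mathcal A(G)$ (a finite multiset of atoms) whose atoms concatenate to $S$; $|z|$ is its number of atoms counted with multiplicity; $\mathsf Z(S)$ is the set of all factorizations of $S$ and $\mathsf L(S)=\{|z| : z\in\mathsf Z(S)\}$. Set of distances. For $A\subseteq\mathbb Z$, $\Delta(A)$ is the set of all positive integers $d$ for which there is $\ell\in A$ with $A\cap[\ell,\ell+d]=\{\ell,\ell+d\}$. $\Delta(G)=\bigcup_{S\in\mathcal B(G)}\Delta(\mathsf L(S))$. $\daleth^{*}(G)=\{\min(\mathsf L(S)\setminus\{2\}) : S\in\mathcal B(G),\ 2\in\mathsf L(S),\ \mathsf L(S)\ne\{2\}\}$.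 Catenary degrees. For factorizations $z,z'$, write $z=\gcd(z,z')\,y$, $z'=\gcd(z,z')\,y'$ (gcd in the free abelian monoid on atoms) and set $\mathsf d(z,z')=\max\{|y|,|y'|\}$. For $S\in\mathcal B(G)$, $\mathsf c(S)$ is the smallest $N\in\mathbb N_0\cup\{\infty\}$ such that any two $z,z'\in\mathsf Z(S)$ can be joined by a finite sequence $z=z_0,z_1,\ldots,z_k=z'$ in $\mathsf Z(S)$ with $\mathsf d(z_{i-1},z_i)\le N$ for all $i\in[1,k]$. $\mathsf{Ca}(G)=\{\mathsf c(S) : S\in\mathcal B(G),\ \mathsf c(S)\ge 2\}$. *)

(* Defs.v *)
From HB Require Import structures.
From mathcomp Require Import all_boot all_fingroup all_solvable.
From mathcomp Require Import finmap multiset.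
From mathcomp Require Import boolp classical_sets.

Set Implicit Arguments.
Unset Strict Implicit.
Unset Printing Implicit Defensive.

Local Open Scope mset_scope.
Local Open Scope classical_set_scope.

(* [is_min le A m] : m is the smallest element of A. *)
Definition is_min (T : Type) (le : rel T) (A : set T) (m : T) : Prop :=
  A m /\ forall n, A n -> le m n.

(* The order on N_0 u {oo}, where None stands for oo. *)
Definition leoo (m n : option nat) : bool :=
  match m, n with
  | _, None => true
  | None, Some _ => false
  | Some m, Some n => m <= n
  end.

Definition interval (a b : nat) : set nat := [set x | a <= x <= b].

(* Only sets of natural numbers are needed: sets of lengths are such sets, and
   for l in A the integer interval [l, l + d] consists of natural numbers. *)
Definition delta (A : set nat) : set nat :=
  [set d | 0 < d /\
           exists2 l, A l & A `&` interval l (l + d) = [set l; l + d]].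

Section ProductOne.
Variable gT : finGroupType.
Implicit Types (S A B : {mset gT}) (z : {mset {mset gT}}).

(* The free abelian monoid F(G) on the group G is {mset gT}, with `+` as its
   operation; s ranges over the orderings of the terms of S. *)
Definition product_one : set {mset gT} :=
  [set S : {mset gT} |
    exists2 s : seq gT, perm_eq s S & (\prod_(g <- s) g = 1)%g].

Definition atom : set {mset gT} :=
  [set S : {mset gT} | [/\ product_one S, S <> mset0 &
    ~ exists A B, [/\ product_one A, product_one B, A <> mset0, B <> mset0 &
                      S = (A `+` B)%mset]]].

Definition factorizations S : set {mset {mset gT}} :=
  [set z : {mset {mset gT}} |
    (forall A : {mset gT}, A \in z -> atom A) /\
    \big[@msetD gT/mset0]_(A <- z) A = S].

Definition lengths S : set nat :=
  [set n | exists2 z, factorizations S z & size z = n].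

Definition distances : set nat :=
  \bigcup_(S in product_one) delta (lengths S).

Definition daleth_star : set nat :=
  [set m | exists S, [/\ product_one S, lengths S 2, lengths S <> [set 2] &
                         is_min leq (lengths S `\ 2) m]].

(* z `&` z' is the gcd of z and z'. *)
Definition fdist z z' : nat :=
  maxn (size (z `\` (z `&` z'))%mset) (size (z' `\` (z `&` z'))%mset).

Definition joined S (N : option nat) z z' : Prop :=
  exists s : seq {mset {mset gT}},
    [/\ forall x, x \in s -> factorizations S x,
        path (fun x y => leoo (Some (fdist x y)) N) z s & last z s = z'].

(* [catenary_degree S N] says c(S) = N. *)
Definition catenary_degree S : set (option nat) :=
  is_min leoo [set N | forall z z', factorizations S z ->
                         factorizations S z' -> joined S N z z'].

(* A priori a subset of N_0 u {oo}. *)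
Definition catenary_degrees : set (option nat) :=
  [set N | exists S, [/\ product_one S, catenary_degree S N &
                         leoo (Some 2) N]].

End ProductOne.

(* The smallest element defining c(S) exists, as None always qualifies, and it
   is unique. *)
Lemma catenary_degree_exists_unique (gT : finGroupType) (S : {mset gT}) :
  exists! N, catenary_degree S N.
Proof.
set P := [set N | forall z z', factorizations S z ->
                    factorizations S z' -> joined S N z z'].
suff [N minN] : exists N, is_min leoo P N.
  exists N; split => // M [PM minM]; case: minN => PN minN.
  case: N M PN minN PM minM => [n|] [m|] PN minN PM minM //.
  - have := minN _ PM; have := minM _ PN => /= le1 le2.
    by congr Some; apply/eqP; rewrite eqn_leq le1 le2.
  - by have := minM _ PN.
  - by have := minN _ PM.
have [[n Pn]|noP] := pselect (exists n, P (Some n)).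
  have exP : exists n, `[< P (Some n) >] by exists n; apply/asboolP.
  exists (Some (ex_minn exP)); case: ex_minnP => m /asboolP Pm minm.
  by split => // -[k|] Pk //=; apply: minm; apply/asboolP.
exists None; split => [z z' _ Fz'|[k|] Pk //]; last by case: noP; exists k.
by exists [:: z']; split => // x; rewrite inE => /eqP ->.
Qed.

(* Main.v *)
Require Import Defs.
From HB Require Import structures.
From mathcomp Require Import all_boot all_fingroup all_solvable.
From mathcomp Require Import finmap multiset zify.
From mathcomp Require Import boolp classical_sets.

Set Implicit Arguments.
Unset Strict Implicit.
Unset Printing Implicit Defensive.

Local Open Scope classical_set_scope.
Local Open Scope mset_scope.

(** In [Q_8] one has [ji = (-1)ij], and likewise for any two non-commuting
    elements, while the quotient by [{1, -1}] is the Klein four-group.  Hence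
    a sequence is product-one if and only if its numbers of terms in
    [{i, -i}], in [{j, -j}] and in [{k, -k}] have the same parity and, when all
    its terms lie in one cyclic subgroup, their product is 1.  When they do not
    lie in one cyclic subgroup, two of them do not commute, and exchanging them
    as neighbours changes the sign of the product ([product_oneE]).  So the
      product-one sequences are the
    [balanced] vectors of 8 multiplicities, and there are exactly 120 atoms,
    all of length at most 6 ([atomE]).

    The heart of the proof is that every catenary degree is at most 4
    ([joined4]), by induction on the length of the sequence [S].  It suffices
    to find an atom [V] such that every factorization of [S] can be joined to
    one containing [V], because [V] can then be cancelled.  A fixed list of 27
    atoms, the [pivots], is used: [V] is the first pivot that divides [S] with
    a product-one complement.  Such a pivot exists unless [S] has length at
    most 9 and does not contain 1, so that all its factorizations have at most
    4 atoms ([pivot_or_short]).  Given a factorization [z] of [S], at most four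
    atoms of [z] already contain [V] with a product-one complement
    ([searchP]), and a finite computation ([search_all_pivots]) shows that the
    product of these atoms is [V] times at most three atoms.  For a few
    products this fails, but then some other pivot [K] does have this
    property and can be split off together with [V]; the induction hypothesis
    for [S] without [K] joins the resulting factorization to one containing
    both [K] and [V] ([pivot_reach]).

    The remaining upper bounds follow, since two different factorizations
    whose lengths differ by [d] are at distance at least [d + 2]
    ([fdist_geq]): a chain of steps of size at most 4 changes the length by at
    most 2 at a time.  Three sequences with sets of lengths [{2}], [{2, 3}] and
    [{2, 4}] show that all the values in question occur. *)

(** * Factorizations over an arbitrary finite group *)

Section Multisets.
Variable K : choiceType.
Implicit Types A B C : {mset K}.

Lemma msetD_assoc : associative (@msetD K).
Proof. exact: msetDA. Qed.

Lemma mset0D_id : left_id mset0 (@msetD K).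
Proof. exact: mset0D. Qed.

HB.instance Definition _ :=
  Monoid.isComLaw.Build {mset K} mset0 (@msetD K) msetD_assoc (@msetDC K)
    mset0D_id.

Lemma perm_msetD A B : perm_eq (A `+` B) (A ++ B).
Proof.
by apply/allP => a _ /=; rewrite count_cat !count_mem_mset msetE2.
Qed.

Lemma size_msetD A B : size (A `+` B) = size A + size B.
Proof. by rewrite (perm_size (perm_msetD A B)) size_cat. Qed.

Lemma msetD_eq0 A B : (A `+` B == mset0) = (A == mset0) && (B == mset0).
Proof. by rewrite -!size_mset_eq0 size_msetD addn_eq0. Qed.

Lemma msetD_inj A : injective (msetD A).
Proof. exact: can_inj (msetDKB A). Qed.

Lemma mset_split a A : a \in A -> exists B, A = [mset a] `+` B.
Proof. by move=> aA; exists (A `\ a); rewrite msetB1K. Qed.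

Lemma size_mset1 (a : K) : size [mset a] = 1.
Proof. by rewrite enum_msetn size_nseq. Qed.

End Multisets.

Section Factorizations.
Variable gT : finGroupType.
Implicit Types (S T A B : {mset gT}) (y z w : {mset {mset gT}}).

Definition msum z : {mset gT} := \big[@msetD gT/mset0]_(A <- z) A.

Lemma msum0 : msum mset0 = mset0.
Proof. by rewrite /msum big_mset0. Qed.

Lemma msum1 A : msum [mset A] = A.
Proof. by rewrite /msum big_msetn. Qed.

Lemma msumD z w : msum (z `+` w) = msum z `+` msum w.
Proof. by rewrite /msum (perm_big _ (perm_msetD z w)) big_cat. Qed.

Lemma product_one0 : product_one (mset0 : {mset gT}).
Proof. by exists [::]; rewrite ?big_nil ?enum_mset0. Qed.

Lemma product_oneD S T :
  product_one S -> product_one T -> product_one (S `+` T).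
Proof.
move=> [s sS s1] [t tT t1]; exists (s ++ t); last by rewrite big_cat /= s1 t1 mulg1.
by rewrite (perm_trans (perm_cat sS tT)) // perm_sym perm_msetD.
Qed.

Lemma atom_neq0 A : atom A -> A != mset0.
Proof. by case=> _ /eqP. Qed.

Lemma factorizations0 : factorizations (mset0 : {mset gT}) mset0.
Proof. by split; [move=> A; rewrite in_mset0 | exact: msum0]. Qed.

Lemma factorizations1 A : atom A -> factorizations A [mset A].
Proof. by move=> atA; split; [move=> B /mset1P -> | exact: msum1]. Qed.

Lemma factorizationsD S T z w : factorizations S z -> factorizations T w ->
  factorizations (S `+` T) (z `+` w).
Proof.
move=> [zat zS] [wat wT]; split; last first.
  by rewrite -/(msum _) msumD -zS -wT.
by move=> A /msetDP[/zat|/wat].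
Qed.

Lemma factorizations_split S z w : factorizations S (z `+` w) ->
  [/\ factorizations (msum z) z, factorizations (msum w) w &
      S = msum z `+` msum w].
Proof.
move=> [zwat zwS]; split; rewrite -?msumD //; split=> // A Ain; apply: zwat.
  by rewrite in_msetD Ain.
by rewrite in_msetD Ain orbT.
Qed.

Lemma factorizations_product_one S z : factorizations S z -> product_one S.
Proof.
case=> + <-; rewrite big_seq => zat; apply: (big_ind _ _ product_oneD).
  exact: product_one0.
by move=> A /zat[].
Qed.

Lemma factorizations_exists S : product_one S -> exists z, factorizations S z.
Proof.
have [n] := ubnP (size S); elim: n S => // n IHn S; rewrite ltnS => leSn poS.
have [S0|S0] := eqVneq S mset0; first by rewrite S0; exists mset0;
  exact: factorizations0.
have [atS|natS] := pselect (atom S); first by exists [mset S]; exact: factorizations1.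
have [A [B [poA poB /eqP A0 /eqP B0 SE]]] : exists A B,
    [/\ product_one A, product_one B, A <> mset0, B <> mset0 & S = A `+` B].
  by apply: contrapT => noAB; apply: natS; split=> //; exact/eqP.
have [ltAS ltBS] : size A < size S /\ size B < size S.
  by move: A0 B0; rewrite -!size_mset_eq0 SE size_msetD; lia.
have [z Az] := IHn _ (leq_trans ltAS leSn) poA.
have [w Bw] := IHn _ (leq_trans ltBS leSn) poB.
by exists (z `+` w); rewrite SE; exact: factorizationsD.
Qed.

Lemma factorizations_of0 z : factorizations (mset0 : {mset gT}) z -> z = mset0.
Proof.
have [-> //|[A /mset_split[w ->]]] := mset_0Vmem z.
move=> zw; have [_ _ /esym/eqP] := factorizations_split zw.
rewrite msetD_eq0 msum1 => /andP[/eqP A0 _].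
have /atom_neq0 : atom A by case: zw => + _; apply; exact: mset1D1.
by rewrite A0 eqxx.
Qed.

(** A factorization of an atom is trivial: any other one would split the atom
    into two non-empty product-one sequences. *)
Lemma factorizations_atom A z : atom A -> factorizations A z -> z = [mset A].
Proof.
move=> atA; have [-> zA|[B /mset_split[w ->] Azw]] := mset_0Vmem z.
  by have := atom_neq0 atA; case: zA => _; rewrite -/(msum _) msum0 => <- /eqP.
have [B_z w_w AE] := factorizations_split Azw; rewrite msum1 in B_z AE.
have atB : atom B by case: Azw => + _; apply; exact: mset1D1.
have [w0|w0] := eqVneq (msum w) mset0.
  by rewrite w0 msetD0 in AE; rewrite w0 in w_w;
    rewrite (factorizations_of0 w_w) AE msetD0.
case: atA => _ _ []; exists B, (msum w); split=> //; try exact/eqP.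
- exact: factorizations_product_one B_z.
- exact: factorizations_product_one w_w.
- exact/eqP/atom_neq0.
Qed.

Lemma fdistC z w : fdist z w = fdist w z.
Proof. by rewrite /fdist maxnC msetIC. Qed.

(** This lets a chain for a part of a sequence be extended to the whole. *)
Lemma fdistDr z z' w : fdist (z `+` w) (z' `+` w) = fdist z z'.
Proof.
suff cancel x x' : (x `+` w) `\` ((x `+` w) `&` (x' `+` w)) = x `\` (x `&` x').
  by rewrite /fdist cancel [(z `+` w) `&` _]msetIC cancel [z' `&` z]msetIC.
by apply/msetP => A; rewrite !msetE2; lia.
Qed.

Lemma fdist_leq z z' : fdist z z' <= maxn (size z) (size z').
Proof.
have leB x x' : size (x `\` x') <= size x.
  have xE : x = (x `\` x') `+` (x `&` x').
    by apply/msetP => A; rewrite !msetE2; lia.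
  by rewrite [in leqRHS]xE size_msetD leq_addr.
by rewrite /fdist geq_max !leq_max !leB orbT.
Qed.

(** Once the common atoms are removed, the two remaining factorizations of a
    same sequence have no atom in common, so neither of them is empty or
    consists of a single atom. *)
Lemma fdist_geq S z z' : factorizations S z -> factorizations S z' ->
  z <> z' -> 2 + (size z' - size z) <= fdist z z'.
Proof.
move=> zS z'S zz'; set g := z `&` z'.
have [zE z'E] : z = g `+` (z `\` g) /\ z' = g `+` (z' `\` g).
  by split; rewrite msetBDKC // ?msubsetIl ?msubsetIr.
move: (zS) (z'S); rewrite {1}zE {1}z'E.
move=> /factorizations_split[_ yS SE] /factorizations_split[_ y'S S'E].
set y := z `\` g in zE yS SE; set y' := z' `\` g in z'E y'S S'E.
have yy' : msum y' = msum y by apply: (@msetD_inj _ (msum g)); rewrite -S'E.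
have disj A : A \in y -> A \in y' -> False.
  by rewrite !in_mset !msetE2; lia.
have neq : y <> y' by move=> eqy; apply: zz'; rewrite zE z'E eqy.
have ge2 x x' : factorizations (msum x) x -> factorizations (msum x) x' ->
    (forall A, A \in x -> A \in x' -> False) -> x <> x' -> 2 <= size x.
  move=> xS x'S dis; have [x0|[A /mset_split[w xE]]] := mset_0Vmem x.
    by rewrite x0 msum0 in x'S *; rewrite (factorizations_of0 x'S).
  have [w0|[B /mset_split[u wE]]] := mset_0Vmem w; last first.
    by rewrite xE wE !size_msetD !size_mset1.
  move=> xx'; case: xx'; rewrite xE w0 msetD0.
  move: x'S xS; rewrite xE w0 msetD0 msum1 => x'S [+ _].
  by move=> /(_ _ (mset11 _)) /factorizations_atom /(_ x'S) ->.
have size_y : 2 <= size y.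
  by apply: (ge2 y y') => //; rewrite -yy'.
have size_y' : 2 <= size y'.
  by apply: (ge2 y' y) => // [|A ? ?|/esym //]; [rewrite yy' | exact: (disj A)].
rewrite /fdist -/g -/y -[in X in maxn _ X]/g -/y' zE z'E !size_msetD; lia.
Qed.

Lemma joined_refl S N z : joined S N z z.
Proof. by exists [::]. Qed.

Lemma joined_trans S N z z' z'' :
  joined S N z z' -> joined S N z' z'' -> joined S N z z''.
Proof.
move=> [s [sS ps lasts]] [t [tS pt lastt]]; exists (s ++ t).
split; last by rewrite last_cat lasts.
- by move=> x; rewrite mem_cat => /orP[/sS|/tS].
- by rewrite cat_path ps lasts.
Qed.

Lemma joined_sym S N z z' :
  factorizations S z -> joined S N z z' -> joined S N z' z.
Proof.
move=> zS [s [sS ps <-]]; exists (rev (belast z s)); split.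
- by move=> x; rewrite mem_rev => /mem_belast; rewrite inE => /orP[/eqP->|/sS].
- by rewrite rev_path; under eq_path do rewrite fdistC.
- by case: s {sS ps} => //= a s; rewrite rev_cons last_rcons.
Qed.

Lemma joined_step S n z z' : factorizations S z' -> fdist z z' <= n ->
  joined S (Some n) z z'.
Proof.
move=> z'S le; exists [:: z']; split=> //=; last by rewrite le.
by move=> x; rewrite inE => /eqP->.
Qed.

Lemma joined_add S T N z z' w : factorizations T w ->
  joined S N z z' -> joined (S `+` T) N (z `+` w) (z' `+` w).
Proof.
move=> wT [s [sS ps <-]]; exists [seq x `+` w | x <- s]; split.
- by move=> _ /mapP[x /sS xS ->]; exact: factorizationsD.
- elim: s z ps {sS} => //= x s IHs z /andP[zx /IHs->].
  by rewrite fdistDr zx.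
- by rewrite (last_map (fun x => x `+` w)).
Qed.

(** The atoms of [w] are common to both factorizations, so that only the
    numbers of exchanged atoms count. *)
Lemma joined_exchange n S u u' w : factorizations S (u `+` w) ->
  factorizations (msum u) u' -> size u <= n -> size u' <= n ->
  joined S (Some n) (u `+` w) (u' `+` w).
Proof.
move=> Suw uu' un u'n; have [_ ww SE] := factorizations_split Suw.
apply: joined_step; first by rewrite SE; exact: factorizationsD.
by rewrite fdistDr (leq_trans (fdist_leq _ _)) // geq_max un.
Qed.

End Factorizations.

(** * Lengths and catenary degrees *)

Section LengthsAndCatenary.
Variable gT : finGroupType.
Implicit Types (S T A B : {mset gT}) (z : {mset {mset gT}}).

Lemma lengths_ge2 S l : lengths S 2 -> lengths S l -> 2 <= l.
Proof.
case=> z2 Sz2 size2 [z Sz <-].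
have [z0|[A /mset_split[w zE]]] := mset_0Vmem z.
  move: Sz Sz2 size2; rewrite z0 => -[_]; rewrite -/(msum _) msum0 => <-.
  by move=> /factorizations_of0->; rewrite size_mset0.
have [w0|[B /mset_split[u wE]]] := mset_0Vmem w; last first.
  by rewrite zE wE !size_msetD !size_mset1.
move: Sz Sz2 size2; rewrite zE w0 msetD0 => -[zat]; rewrite -/(msum _) msum1 => <-.
by move/(factorizations_atom (zat A (mset11 A)))->; rewrite size_mset1.
Qed.

Lemma joined_neq S n z z' : factorizations S z -> joined S (Some n) z z' ->
  z <> z' -> 2 <= n.
Proof.
move=> Sz [s [sS ps <-]]; elim: s z Sz sS ps => //= x s IHs z Sz sS.
case/andP=> zx ps zlast.
have [zx_eq|/eqP zx_neq] := eqVneq z x.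
  apply: (IHs x) => // [|y ys|]; first by rewrite -zx_eq.
    by apply: sS; rewrite inE ys orbT.
  by move: zlast; rewrite zx_eq.
apply: leq_trans zx; apply: leq_trans (fdist_geq Sz _ zx_neq); first exact: leq_addr.
by apply: sS; rewrite mem_head.
Qed.

(** The chain has to jump over the gap between [l] and [l + d] in one step,
    and this step has size at least [d + 2]. *)
Lemma joined_gap S n l d z z' : factorizations S z -> joined S (Some n) z z' ->
  (forall m, lengths S m -> m <= l \/ l + d <= m) ->
  size z <= l -> 0 < d -> l + d <= size z' -> d + 2 <= n.
Proof.
have arith a b : a <= l -> l + d <= b -> d + 2 <= 2 + (b - a) by lia.
move=> Sz [s [sS ps <-]] gap zl d0; elim: s z Sz sS ps zl => [|x s IHs] z Sz sS /=.
  by move=> _ zl le; move: (leq_trans le zl); rewrite -{2}(addn0 l) leq_add2l leqNgt d0.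
case/andP=> zx ps zl lastl.
have Sx : factorizations S x by apply: sS; rewrite mem_head.
have [|xl|xl] := gap (size x); first by exists x.
  by apply: (IHs x) => // y ys; apply: sS; rewrite inE ys orbT.
apply: leq_trans zx; apply: leq_trans (fdist_geq Sz Sx _); first exact: arith.
move=> zx_eq;
  move: (leq_trans xl (eq_leq (congr1 (fun t => size (enum_mset t)) (esym zx_eq)))).
by move/leq_trans/(_ zl); rewrite -{2}(addn0 l) leq_add2l leqNgt d0.
Qed.

(** The first step that leaves the length 2 has size at least the new length. *)
Lemma joined_leave S n z z' : factorizations S z -> joined S (Some n) z z' ->
  size z = 2 -> size z' <> 2 -> exists2 l, lengths S l & (l != 2) && (l <= n).
Proof.
have arith a b : a = 2 -> b <= 2 + (b - a) by lia.
move=> Sz [s [sS ps <-]]; elim: s z Sz sS ps => [|x s IHs] z Sz sS //=.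
case/andP=> zx ps z2 lastl.
have Sx : factorizations S x by apply: sS; rewrite mem_head.
have [x2|x2] := eqVneq (size x) 2.
  by apply: (IHs x) => // y ys; apply: sS; rewrite inE ys orbT.
exists (size x); first by exists x.
rewrite x2; apply: leq_trans zx; apply: leq_trans (fdist_geq Sz Sx _);
  first exact: arith.
by move=> zx_eq; move: x2; rewrite -zx_eq z2.
Qed.

Lemma catenary_degree_unique_length S z z' : lengths S = [set 2] ->
  factorizations S z -> factorizations S z' -> z <> z' ->
  catenary_degree S (Some 2).
Proof.
move=> L2 Sz Sz' zz'; have size2 t : factorizations S t -> size t = 2.
  by move=> St; have : lengths S (size t) by [exists t]; rewrite L2.
split=> [t t' St St'|[n|//] /(_ z z' Sz Sz') zz'n]; last exact: joined_neq zz'n zz'.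
by apply: joined_step => //; rewrite (leq_trans (fdist_leq _ _)) // !size2.
Qed.

(** The largest length bounds all distances, and a chain between
    factorizations of the two lengths has to jump from one to the other. *)
Lemma catenary_degree_two_lengths S d : 2 < d -> lengths S = [set 2; d] ->
  catenary_degree S (Some d).
Proof.
move=> d2 LS; have leS t : factorizations S t -> size t <= d.
  move=> St; have : lengths S (size t) by exists t.
  by rewrite LS => -[->|->] //; exact: ltnW.
have [[z Sz z2] [z' Sz' z'd]] : lengths S 2 /\ lengths S d.
  by rewrite LS; split; [left | right].
split=> [t t' St St'|[n|//] /(_ z z' Sz Sz') zz'n].
  apply: joined_step => //; apply: leq_trans (fdist_leq _ _) _.
  by rewrite geq_max; apply/andP; split; exact: leS.
suff : (d - 2) + 2 <= n by rewrite subnK // ltnW.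
apply: (joined_gap Sz zz'n (l := 2)); rewrite ?z2 ?z'd ?subnKC ?subn_gt0 ?(ltnW d2) //.
by move=> m; rewrite LS => -[->|->]; [left | right].
Qed.

Lemma daleth_star_two_lengths S d : 2 < d -> lengths S = [set 2; d] ->
  daleth_star gT d.
Proof.
move=> d2 LS; have [z Sz _] : lengths S 2 by rewrite LS; left.
exists S; split; rewrite ?LS; first exact: factorizations_product_one Sz.
- by left.
- move/seteqP => [/(_ d)] + _ => /(_ (or_intror erefl)) /= d_2.
  by rewrite d_2 in d2.
split; first by split; [right | move=> /= d_2; rewrite d_2 in d2].
by move=> n [[->|-> _]] // /(_ erefl).
Qed.

Lemma distances_two_lengths S d : 0 < d -> lengths S = [set 2; 2 + d] ->
  distances gT d.
Proof.
move=> d0 LS; have [z Sz _] : lengths S 2 by rewrite LS; left.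
exists S; first exact: factorizations_product_one Sz.
split=> //; exists 2; rewrite LS; first by left.
apply/seteqP; split=> [n []|n] //.
by case=> ->; split; rewrite /interval /= ?leqnn ?leq_addr //; [left | right].
Qed.

End LengthsAndCatenary.

(** * Multiplicity vectors *)

(** The multiplicities of [1, -1, i, -i, j, -j, k, -k] in a sequence. *)
Record vec := Vec { n1 : nat; nm : nat; ni : nat; ni' : nat;
                    nj : nat; nj' : nat; nk : nat; nk' : nat }.

Definition coords v := [:: n1 v; nm v; ni v; ni' v; nj v; nj' v; nk v; nk' v].

Definition of_coords s := Vec (nth 0 s 0) (nth 0 s 1) (nth 0 s 2) (nth 0 s 3)
                              (nth 0 s 4) (nth 0 s 5) (nth 0 s 6) (nth 0 s 7).

Lemma coordsK : cancel coords of_coords. Proof. by case. Qed.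

HB.instance Definition _ := Equality.copy vec (can_type coordsK).

Definition vadd u v :=
  let: Vec p1 pm pi pi' pj pj' pk pk' := u in
  let: Vec q1 qm qi qi' qj qj' qk qk' := v in
  Vec (p1 + q1) (pm + qm) (pi + qi) (pi' + qi') (pj + qj) (pj' + qj')
      (pk + qk) (pk' + qk').

Definition vsub u v :=
  let: Vec p1 pm pi pi' pj pj' pk pk' := u in
  let: Vec q1 qm qi qi' qj qj' qk qk' := v in
  Vec (p1 - q1) (pm - qm) (pi - qi) (pi' - qi') (pj - qj) (pj' - qj')
      (pk - qk) (pk' - qk').

Definition vle u v :=
  let: Vec p1 pm pi pi' pj pj' pk pk' := u in
  let: Vec q1 qm qi qi' qj qj' qk qk' := v in
  [&& p1 <= q1, pm <= qm, pi <= qi, pi' <= qi', pj <= qj, pj' <= qj',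
      pk <= qk & pk' <= qk'].

Definition vzero := Vec 0 0 0 0 0 0 0 0.
Definition vsize v := sumn (coords v).

Definition parity v :=
  (odd (ni v + ni' v) == odd (nj v + nj' v)) &&
  (odd (nj v + nj' v) == odd (nk v + nk' v)).

(** The number of pairs among [{i, -i}], [{j, -j}], [{k, -k}] that are met; the
    terms of the sequence commute with each other if and only if it is at
    most 1. *)
Definition axes v :=
  (0 < ni v + ni' v) + (0 < nj v + nj' v) + (0 < nk v + nk' v).

(** If the terms lie in the cyclic group generated by [g = i, j] or [k], then
    their product is [g ^+ quarter v], as [-1 = g ^+ 2] and [-g = g ^+ 3]. *)
Definition quarter v :=
  2 * nm v + (ni v + nj v + nk v) + 3 * (ni' v + nj' v + nk' v).

Definition balanced v := parity v && ((1 < axes v) || (4 %| quarter v)).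

(** Quantification over the finitely many vectors below a bound, in a form that
    can be evaluated. *)
Fixpoint all_below (c : seq nat) (P : seq nat -> bool) : bool :=
  if c is n :: c' then all (fun a => all_below c' (fun s => P (a :: s))) (iota 0 n.+1)
  else P [::].

Definition vall (bound : vec) (P : pred vec) :=
  all_below (coords bound) (fun s => P (of_coords s)).

Definition vatom v :=
  [&& v != vzero, balanced v &
      vall v (fun u =>
        [|| u == vzero, u == v, ~~ balanced u | ~~ balanced (vsub v u)])].

Fixpoint bounded_lists (c : seq nat) n :=
  if c is _ :: c' then
    [seq a :: s | a <- iota 0 n.+1, s <- bounded_lists c' (n - a)]
  else [:: [::]].

(** No atom has length more than 6; that none is missed is a consequence of
    [pivot_or_short], see [atomE]. *)
Definition atoms : seq vec := Eval lazy in
  [seq v <- [seq of_coords s | s <- bounded_lists (coords vzero) 6] | vatom v].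

Definition removable V v := vle V v && balanced (vsub v V).

(** These are, in this order, [1], [-1 -1], the pairs [g g^-1], the sequences
    [-1 g h l] and [g h l] with [g = i, -i], [h = j, -j] and [l = k, -k], and
    the fourth powers of [i, -i, j, -j, k, -k].  The order matters: the first
    removable pivot is used, and the absence of removable pairs leaves few
    factorizations to be considered for the later pivots. *)
Definition pivots : seq vec := Eval lazy in
  let sign := [:: [:: 1; 0]; [:: 0; 1]] in
  let signs := [seq a ++ s | a <- sign, s <- [seq b ++ c | b <- sign, c <- sign]] in
  [:: Vec 1 0 0 0 0 0 0 0; Vec 0 2 0 0 0 0 0 0;
      Vec 0 0 1 1 0 0 0 0; Vec 0 0 0 0 1 1 0 0; Vec 0 0 0 0 0 0 1 1] ++
  [seq of_coords [:: 0, 1 & s] | s <- signs] ++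
  [seq of_coords [:: 0, 0 & s] | s <- signs] ++
  [seq of_coords (0 :: 0 :: nseq i 0 ++ [:: 4]) | i <- iota 0 6].

Definition missing V s := find (fun p => p.1 < p.2) (zip (coords s) (coords V)).

Definition atoms_with : seq (seq vec) := Eval lazy in
  [seq [seq U <- atoms | 0 < nth 0 (coords U) c] | c <- iota 0 8].

(** A sufficient criterion for a balanced vector to be a product of at most
    [n] atoms.  Without the term 1 all atoms have length at least 2, so that
    a short vector cannot have too many factors. *)
Fixpoint short n v :=
  if vsize v <= n.*2.+1 then n1 v == 0 else
  if n is n'.+1 then
    has (fun U => removable U v && short n' (vsub v U)) (rev atoms)
  else false.

(** Here [s] is the product of at most four atoms of a factorization.  Either
    they can be replaced by [V] and at most three atoms, or by a pivot [K] and
    at most three atoms, in such a way that [V] can still be removed together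
    with [K]. *)
Definition exchangeable V s :=
  short 3 (vsub s V) ||
  has (fun K => [&& removable K s, short 3 (vsub s K) & removable V (vsub s K)])
      pivots.

(** The candidates for the next atom when [s] is the product of the atoms
    already collected: if [V] does not divide [s], an atom containing a missing
    element; otherwise, an atom that makes the complement of [V] balanced. *)
Definition extensions V s :=
  if vle V s then [seq U <- atoms | balanced (vadd (vsub s V) U)]
  else nth [::] atoms_with (missing V s).

(** However candidates are added to [s] one after another, an exchangeable
    vector is reached after at most [k] of them, unless a pivot from [early]
    becomes removable before.  If [V] divides [s] but the complement is not
    balanced, then a single further atom repairs it, provided that the
    complement meets an axis ([balanced_extend]). *)
Fixpoint search V early k s :=
  if has (fun W => removable W s) early then true else
  if removable V s then exchangeable V s else
  if k is k'.+1 then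
    (vle V s ==> (0 < axes (vsub s V))) &&
    all (fun U => search V early k' (vadd s U)) (extensions V s)
  else false.

(** The lengths of the factorizations of [v], with repetitions, provided that
    [n] is at least the size of [v]. *)
Fixpoint vlengths n v : seq nat :=
  if v == vzero then [:: 0] else
  if n is n'.+1 then
    flatten [seq [seq l.+1 | l <- vlengths n' (vsub v U)]
            | U <- nth [::] atoms_with (missing v vzero) & vle U v]
  else [::].

Lemma atoms_vatom : all vatom atoms. Proof. by lazy. Qed.

Lemma atoms_big : all (fun U => (0 < n1 U) || (1 < vsize U)) atoms.
Proof. by lazy. Qed.

Lemma pivots_atoms : all (mem atoms) pivots. Proof. by lazy. Qed.

Lemma bounded_pivot_or_short : vall (Vec 0 1 4 4 4 4 4 4) (fun v => balanced v ==>
  [|| v == vzero, has (removable^~ v) pivots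
    | (vsize v <= 9) && has (removable^~ v) atoms ]).
Proof. by lazy. Qed.

Lemma search_all_pivots :
  all (fun i => search (nth vzero pivots i) (take i pivots) 4 vzero)
      (iota 0 (size pivots)).
Proof. by lazy. Qed.

Ltac by_coords := intros;
  repeat match goal with v : vec |- _ => destruct v end;
  unfold vsize, balanced, parity, axes, quarter, vzero in *; simpl in *;
  try (congr Vec); lia.

Lemma vaddC : commutative vadd. Proof. by move=> u v; by_coords. Qed.

Lemma vaddA : associative vadd. Proof. by move=> u v w; by_coords. Qed.

Lemma vadd0 : right_id vzero vadd. Proof. by move=> u; by_coords. Qed.

Lemma vle0 v : vle v vzero -> v = vzero.
Proof. by_coords. Qed.

Lemma vsubK u v : vle u v -> vadd u (vsub v u) = v.
Proof. by_coords. Qed.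

Lemma vaddK u v : vsub (vadd u v) u = v.
Proof. by_coords. Qed.

Lemma vle_add u v : vle u (vadd u v).
Proof. by_coords. Qed.

Lemma vsizeD u v : vsize (vadd u v) = vsize u + vsize v.
Proof. by_coords. Qed.

Lemma vsize_eq0 v : (vsize v == 0) = (v == vzero).
Proof. by apply/eqP/eqP => [|-> //]; by_coords. Qed.

Lemma quarterD u v : quarter (vadd u v) = quarter u + quarter v.
Proof. by_coords. Qed.

Lemma parityD u v : parity u -> parity (vadd u v) = parity v.
Proof.
case: u v => ? ? pi pi' pj pj' pk pk' [? ? qi qi' qj qj' qk qk'].
have oddACA a b c d : odd (a + b + (c + d)) = odd (a + c) (+) odd (b + d).
  by rewrite addnACA oddD.
rewrite /parity /= !oddACA.
by case: (odd (pi + _)) (odd (pj + _)) (odd (pk + _)) => [] [] [];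
   case: (odd (qi + _)) (odd (qj + _)) (odd (qk + _)) => [] [] [].
Qed.

Lemma axesD u v : axes u <= axes (vadd u v).
Proof. by_coords. Qed.

Lemma balancedD u v : balanced u -> balanced v -> balanced (vadd u v).
Proof.
move=> /andP[pu qu] /andP[pv qv]; rewrite /balanced parityD // pv quarterD /=.
have [|//] := leqP; move=> ax1; have := axesD u v; have := axesD v u.
rewrite vaddC => av au; apply: dvdn_add.
  by move: qu; rewrite ltnNge (leq_trans au).
by move: qv; rewrite ltnNge (leq_trans av).
Qed.

(** As [T + u] is not balanced, it meets only the axis of [T]; so [u], being
    balanced, contributes a multiple of 4 to [quarter].  If [v] stays on this
    axis as well, then [u] can be dropped; if [v] leaves it, then two axes
    are met and [T + v] is balanced. *)
Lemma balanced_extend T u v : parity T -> 0 < axes T -> ~~ balanced (vadd T u) ->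
  balanced u -> balanced v -> balanced (vadd (vadd T u) v) -> balanced (vadd T v).
Proof.
move=> pT aT; rewrite /balanced !quarterD.
case/nandP=> [|/norP[]].
  by move/negP=> + /andP[pu _]; case; rewrite parityD.
rewrite -leqNgt => aTu ndvd /andP[pu qu] /andP[pv qv] /andP[_ q].
rewrite parityD // pv /=; have [aTv|//] := leqP.
have au : axes u <= 1 by apply: leq_trans aTu; rewrite vaddC axesD.
have av : axes v <= 1 by apply: leq_trans aTv; rewrite vaddC axesD.
have aTuv : axes (vadd (vadd T u) v) <= 1.
  by clear -aT aTu aTv; by_coords.
move: q qu qv; rewrite !ltnNge aTuv au av /= => q qu qv.
by move: q; rewrite addnAC dvdn_addl.
Qed.

Lemma all_belowP c P s : all_below c P -> all2 leq s c -> P s.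
Proof.
elim: c s P => [|n c IHc] [|a s] P // /allP/(_ a) Pa /andP[an sc].
by apply: (IHc s (fun s => P (a :: s))) sc; apply: Pa; rewrite mem_iota.
Qed.

Lemma vallP b (P : pred vec) v : vall b P -> vle v b -> P v.
Proof.
move=> /all_belowP Pb vb; rewrite -(coordsK v); apply: Pb.
by clear -vb; by_coords.
Qed.

Lemma vleE u v : vle u v = ~~ has (fun p => p.1 < p.2) (zip (coords v) (coords u)).
Proof. by_coords. Qed.

Lemma missingP V s : ~~ vle V s ->
  missing V s < 8 /\
  nth 0 (coords s) (missing V s) < nth 0 (coords V) (missing V s).
Proof.
rewrite vleE negbK => hasc; have ltc := hasc; rewrite has_find in ltc.
have szip : size (zip (coords s) (coords V)) = 8 by [].
split; first by rewrite -szip.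
by have := nth_find (0, 0) hasc; rewrite nth_zip.
Qed.

Lemma vle_coord u v c : vle u v -> nth 0 (coords u) c <= nth 0 (coords v) c.
Proof.
case: u v => ? ? ? ? ? ? ? ? [] ? ? ? ? ? ? ? ? /=.
by do 8![case: c => [|c]; first by rewrite /=; lia]; rewrite !nth_default.
Qed.

Lemma coordsD u v c :
  nth 0 (coords (vadd u v)) c = nth 0 (coords u) c + nth 0 (coords v) c.
Proof.
case: u v => ? ? ? ? ? ? ? ? [] ? ? ? ? ? ? ? ?.
by do 8![case: c => [|c]; first by []]; rewrite !nth_default.
Qed.

(** Removing [V] changes neither the parities nor [quarter v] modulo 4, so the
    only danger is that an axis disappears. *)
Lemma balanced_sub V v : parity V -> 4 %| quarter V -> vle V v ->
  axes v <= axes (vsub v V) -> balanced v -> balanced (vsub v V).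
Proof.
move=> pV qV /vsubK vE av; rewrite -{1}vE /balanced parityD // quarterD dvdn_addr //.
by case/andP=> -> /orP[lt|->]; rewrite ?orbT // (leq_trans _ av) // -vE.
Qed.

(** If a multiplicity exceeds 4 (or 1 for the element -1, or 0 for the element
    1), then a fourth power (or [-1 -1], or [1]) is removable without losing an
    axis.  The finitely many other vectors are checked one by one. *)
Lemma pivot_or_short v : balanced v -> v != vzero ->
  has (removable^~ v) pivots \/
  [/\ n1 v = 0, vsize v <= 9 & has (removable^~ v) atoms].
Proof.
move=> pov v0.
have pivot V : V \in pivots -> parity V && (4 %| quarter V) ->
    vle V v && (axes v <= axes (vsub v V)) -> has (removable^~ v) pivots.
  move=> Vin /andP[pV qV] /andP[leV avV]; apply/hasP; exists V => //.
  by rewrite /removable leV balanced_sub.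
have [le|] := boolP (vle v (Vec 0 1 4 4 4 4 4 4)).
  have := vallP bounded_pivot_or_short le; rewrite pov (negbTE v0) /=.
  case/orP=> [->|/andP[sz hasU]]; [by left | right; split=> //].
  by clear -le; by_coords.
move=> nle; left; move: nle pivot; rewrite /axes.
case: v {v0 pov} => p1 pm pi pi' pj pj' pk pk' /= nle pivot.
have [q1|q1] := posnP p1; last
  by apply: (pivot (Vec 1 0 0 0 0 0 0 0)) => //=; clear - q1; lia.
have [qm|qm] := ltnP 1 pm.
  by apply: (pivot (Vec 0 2 0 0 0 0 0 0)) => //=; clear - qm; lia.
have [qi|qi] := ltnP 4 pi.
  by apply: (pivot (Vec 0 0 4 0 0 0 0 0)) => //=; clear - qi; lia.
have [qi'|qi'] := ltnP 4 pi'.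
  by apply: (pivot (Vec 0 0 0 4 0 0 0 0)) => //=; clear - qi'; lia.
have [qj|qj] := ltnP 4 pj.
  by apply: (pivot (Vec 0 0 0 0 4 0 0 0)) => //=; clear - qj; lia.
have [qj'|qj'] := ltnP 4 pj'.
  by apply: (pivot (Vec 0 0 0 0 0 4 0 0)) => //=; clear - qj'; lia.
have [qk|qk] := ltnP 4 pk.
  by apply: (pivot (Vec 0 0 0 0 0 0 4 0)) => //=; clear - qk; lia.
have [qk'|qk'] := ltnP 4 pk'.
  by apply: (pivot (Vec 0 0 0 0 0 0 0 4)) => //=; clear - qk'; lia.
by rewrite q1 qm qi qi' qj qj' qk qk' in nle.
Qed.

Lemma atoms_withP c U : c < 8 ->
  (U \in nth [::] atoms_with c) = (0 < nth 0 (coords U) c) && (U \in atoms).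
Proof.
move=> c8.
suff -> : atoms_with = [seq [seq V <- atoms | 0 < nth 0 (coords V) d] | d <- iota 0 8].
  by rewrite (nth_map 0) ?size_iota // nth_iota // mem_filter.
by lazy.
Qed.

(** * Sequences over the quaternion group *)

Section Quaternion.
Variables (gT : finGroupType) (x y : gT).
Hypotheses (ox : #[x]%g = 4) (yy : (y ^+ 2 = x ^+ 2)%g).
Hypotheses (yx : (y * x = x ^+ 3 * y)%g) (yX : y \notin <[x]>%g).
Hypothesis card_gT : #|gT| = 8.

Implicit Types (s : seq gT) (S : {mset gT}).

(** The elements [1, -1, i, -i, j, -j, k, -k] for [i = x], [j = y] and
    [k = xy], in the order of the coordinates of [vec]. *)
Definition elts : seq gT :=
  [:: 1; x ^+ 2; x; x ^+ 3; y; x ^+ 2 * y; x * y; x ^+ 3 * y]%g.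

Lemma x_mod a b : a = b %[mod 4] -> (x ^+ a = x ^+ b)%g.
Proof. by move/eqP; rewrite -ox -eq_expg_mod_order => /eqP. Qed.

Lemma x_eq1 a : (x ^+ a == 1)%g = (4 %| a).
Proof. by rewrite -order_dvdn ox. Qed.

Lemma y_xX a : (y * x ^+ a = x ^+ (3 * a) * y)%g.
Proof.
elim: a => [|a IHa]; first by rewrite mulg1 mul1g.
by rewrite expgSr mulgA IHa -mulgA yx mulgA -expgD mulnS addnC.
Qed.

Lemma y_double a : (y ^+ a.*2 = x ^+ a.*2)%g.
Proof. by rewrite -muln2 mulnC !expgM yy. Qed.

Lemma elts_uniq : uniq elts.
Proof.
have xaxb a b : (x ^+ a == x ^+ b)%g = (a == b %[mod 4]).
  by rewrite eq_expg_mod_order ox.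
have uX : uniq [:: 1; x ^+ 2; x; x ^+ 3]%g.
  rewrite (_ : [:: _; _; _; _] = [seq (x ^+ a)%g | a <- [:: 0; 2; 1; 3]]) //.
  rewrite map_inj_in_uniq // => a b; rewrite !inE => a4 b4 /eqP.
  by rewrite xaxb => /eqP; lia.
have -> : elts = [:: 1; x ^+ 2; x; x ^+ 3]%g ++
    [seq (g * y)%g | g <- [:: 1; x ^+ 2; x; x ^+ 3]%g].
  by rewrite /elts /= mul1g.
rewrite cat_uniq uX (map_inj_uniq (mulIg y)) uX andbT.
apply/hasPn => _ /mapP[g gX ->]; apply: contra yX => gyX.
have subX h : h \in [:: 1; x ^+ 2; x; x ^+ 3]%g -> h \in <[x]>%g.
  by rewrite !inE => /or4P[] /eqP->; rewrite ?group1 ?mem_cycle ?cycle_id.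
by rewrite -(groupMl _ (subX _ gX)) subX.
Qed.

Lemma mem_elts g : g \in elts.
Proof.
have sub : {subset elts <= enum gT} by move=> h _; rewrite mem_enum.
have [|_ ->] := uniq_min_size elts_uniq sub; last by rewrite mem_enum.
by rewrite -cardE card_gT.
Qed.

Definition wcontent s := of_coords [seq count_mem g s | g <- elts].
Definition content S := wcontent S.

Lemma wcontent_coord s c : c < 8 ->
  nth 0 (coords (wcontent s)) c = count_mem (nth 1%g elts c) s.
Proof. by do 8![case: c => [|c] //]. Qed.

Lemma contentE S : content S = of_coords [seq S g | g <- elts].
Proof. by rewrite /content /wcontent; under eq_map do rewrite count_mem_mset. Qed.

Lemma content_coord S c : c < 8 -> nth 0 (coords (content S)) c = S (nth 1%g elts c).
Proof. by move=> c8; rewrite wcontent_coord // count_mem_mset. Qed.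

Lemma content_inj : injective content.
Proof.
move=> S T eqST; apply/msetP => g.
have gE := mem_elts g; rewrite -(nth_index 1%g gE).
by rewrite -!content_coord ?eqST // (_ : 8 = size elts) // index_mem.
Qed.

Lemma wcontent_perm s t : perm_eq s t -> wcontent s = wcontent t.
Proof. by move=> /seq.permP st; congr of_coords; apply: eq_map => g; exact: st. Qed.

Lemma wcontent_cat s t : wcontent (s ++ t) = vadd (wcontent s) (wcontent t).
Proof. by rewrite /wcontent /= !count_cat. Qed.

Lemma contentD S T : content (S `+` T) = vadd (content S) (content T).
Proof. by rewrite /content -wcontent_cat; exact/wcontent_perm/perm_msetD. Qed.

Lemma content0 : content mset0 = vzero.
Proof. by rewrite contentE /= !mset0E. Qed.

Lemma content_surj v : exists S, content S = v.
Proof.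
exists ([fsfun g in [fset h in elts]%fset =>
  nth 0 (coords v) (index g elts)] : {mset gT}).
rewrite contentE -[RHS]coordsK; congr of_coords.
apply: (@eq_from_nth _ 0) => // c; rewrite size_map => ltc.
by rewrite (nth_map 1%g) // fsfunE in_fset mem_elts index_uniq ?elts_uniq.
Qed.

Definition unit_vec c := of_coords [seq (d == c : nat) | d <- iota 0 8].

Lemma wcontent1 c : c < 8 -> wcontent [:: nth 1%g elts c] = unit_vec c.
Proof.
move=> c8; congr of_coords; apply: (@eq_from_nth _ 0) => // d.
rewrite size_map => d8; rewrite (nth_map 1%g) // (nth_map 0) // nth_iota //.
by rewrite /= addn0 nth_uniq ?elts_uniq // eq_sym.
Qed.

Definition xexp c := nth 0 [:: 0; 2; 1; 3; 0; 2; 1; 3] c.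
Definition yexp c : nat := 3 < c.

Lemma elts_xy c : c < 8 -> (nth 1 elts c = x ^+ xexp c * y ^+ yexp c)%g.
Proof. by do 8![case: c => [|c]; first by rewrite /= ?mul1g ?mulg1]. Qed.

(** Moving [x] past [y] cubes it, and [3 ^ b = 1 + 2b] modulo 4. *)
Lemma yX_xX b n : (y ^+ b * x ^+ n = x ^+ (n + 2 * (b * n)) * y ^+ b)%g.
Proof.
elim: b => [|b IHb]; first by rewrite mul1g mulg1 mul0n muln0 addn0.
rewrite expgS -mulgA IHb mulgA y_xX -mulgA; congr (_ * _)%g; apply: x_mod.
by rewrite mulSn; apply/eqP; rewrite eqn_mod_dvd; lia.
Qed.

Lemma mul_xy a b n l : (x ^+ a * y ^+ b * (x ^+ n * y ^+ l) =
  x ^+ (a + n + 2 * (b * n)) * y ^+ (b + l))%g.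
Proof.
by rewrite -mulgA (mulgA (y ^+ b)%g) yX_xX -(mulgA _ (y ^+ b)%g) -expgD mulgA
  -expgD addnA.
Qed.

Lemma xy_norm a b :
  (x ^+ a * y ^+ b = x ^+ (a + b./2.*2) * y ^+ odd b)%g.
Proof. by rewrite -[in LHS](odd_double_half b) addnC expgD y_double mulgA -expgD. Qed.

Lemma xy_eq1 a b : (x ^+ a * y ^+ b == 1)%g = ~~ odd b && (4 %| a + b).
Proof.
rewrite xy_norm -{4}(odd_double_half b); case: (odd b) => /=; last first.
  by rewrite mulg1 x_eq1 add0n.
apply: contraNF (yX) => /eqP/(canRL (mulKg _)) yE; rewrite -(expg1 y) yE.
by rewrite mulg1 groupV mem_cycle.
Qed.

(** The image of the product in the Klein four-group depends on the
    multiplicities only; the sign is hidden in the parity of [t]. *)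
Lemma prod_normal s : exists t, let v := wcontent s in
  (\prod_(g <- s) g = x ^+ (ni v + ni' v + (nk v + nk' v) + t.*2) *
                      y ^+ (nj v + nj' v + (nk v + nk' v)))%g.
Proof.
elim: s => [|g s [t IHs]]; first by exists 0; rewrite big_nil; apply/esym/eqP;
  rewrite xy_eq1.
rewrite big_cons IHs -cat1s wcontent_cat {IHs}.
have := mem_elts g; rewrite -index_mem => ltg.
rewrite -(nth_index 1%g (mem_elts g)) wcontent1 // elts_xy // mul_xy.
move: (index g elts) ltg => c; case: (wcontent s) => p1 pm pi pi' pj pj' pk pk' /=.
set n := (_ + t.*2); set b := (pj + _ + _).
exists ((nm (unit_vec c) + ni' (unit_vec c) + nj' (unit_vec c) + nk' (unit_vec c) +
  yexp c * n + t)).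
by do 8![case: c ltg => [_|c ltg]; first
  by congr (x ^+ _ * y ^+ _)%g; rewrite /n /b /xexp /yexp /=; lia].
Qed.

Lemma elts_axis c : c \in [:: 2; 4; 6] ->
  [/\ (nth 1 elts c ^+ 2 = nth 1 elts 1)%g, (nth 1 elts c ^+ 3 = nth 1 elts c.+1)%g
    & #[nth 1 elts c]%g = 4].
Proof.
move=> c_axis; set g := nth 1%g elts c.
have [g2 g3] : (g ^+ 2 = nth 1 elts 1)%g /\ (g ^+ 3 = nth 1 elts c.+1)%g.
  move: c_axis; rewrite /g !inE => /or3P[] /eqP-> //=.
    by split; rewrite // expgSr yy.
  have xy2 : (x * y * (x * y) = x ^+ 2)%g.
    by rewrite -(expg1 x) -(expg1 y) mul_xy xy_norm mulg1; exact: x_mod.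
  by split; [rewrite expg2 | rewrite expgSr expg2 xy2 mulgA -expgSr].
split=> //.
have : (#[g] %| 4)%g by rewrite order_dvdn (expgM g 2 2) g2 /= -expgM x_eq1.
have : ~~ (#[g] %| 2)%g by rewrite order_dvdn g2 /= x_eq1.
move/[swap]/(dvdn_pfactor _ 2 (isT : prime 2)) => [e e2 ->].
by case: e e2 => [|[|[|]]].
Qed.

(** The coordinates [c] and [c + 1], for [c] one of 2, 4, 6, are those of [g]
    and [-g] with [g = i, j, k]. *)
Lemma prod_axis c s : c \in [:: 2; 4; 6] ->
  {subset s <= [seq nth 1%g elts d | d <- [:: 0; 1; c; c.+1]]} ->
  (\prod_(g <- s) g = nth 1 elts c ^+ quarter (wcontent s))%g.
Proof.
move=> c_axis; have [g2 g3 _] := elts_axis c_axis.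
elim: s => [_|h s IHs sub]; first by rewrite big_nil.
rewrite big_cons -cat1s wcontent_cat quarterD expgD IHs; last first.
  by move=> z zs; apply: sub; rewrite inE zs orbT.
congr (_ * _)%g; have /mapP[d dc ->] := sub h (mem_head _ _).
have d8 : d < 8 by move: dc c_axis; rewrite !inE; lia.
rewrite wcontent1 //.
move: dc; rewrite !inE => /or4P[] /eqP-> //.
- by move: c_axis; rewrite !inE => /or3P[] /eqP->.
- by rewrite -g3; move: c_axis; rewrite !inE => /or3P[] /eqP->.
Qed.

Lemma axes_support v : axes v <= 1 -> exists2 c, c \in [:: 2; 4; 6] &
  forall d, d < 8 -> 0 < nth 0 (coords v) d -> d \in [:: 0; 1; c; c.+1].
Proof.
case: v => p1 pm pi pi' pj pj' pk pk'; rewrite /axes /= => ax.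
have [c c_axis cP] : exists2 c, c \in [:: 2; 4; 6] &
    [&& (c == 2) || (pi + pi' == 0), (c == 4) || (pj + pj' == 0) &
        (c == 6) || (pk + pk' == 0)].
  have [i0|i0] := posnP (pi + pi'); last by exists 2; rewrite //; lia.
  by have [j0|j0] := posnP (pj + pj'); [exists 6 | exists 4] => //; lia.
exists c => // d d8; move: c_axis cP d8; rewrite !inE => /or3P[] /eqP-> /=.
all: by do 8![case: d => [|d]; first by rewrite /=; lia].
Qed.

Lemma prod_abelian s : axes (wcontent s) <= 1 ->
  (\prod_(g <- s) g == 1)%g = (4 %| quarter (wcontent s)).
Proof.
move=> /axes_support[c c_axis cP]; have [_ _ oc] := elts_axis c_axis.
rewrite (prod_axis c_axis) -?order_dvdn ?oc // => g gs.
apply/mapP; exists (index g elts); last by rewrite nth_index ?mem_elts.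
have ltg : index g elts < 8 by rewrite (_ : 8 = size elts) // index_mem mem_elts.
apply: cP; rewrite // wcontent_coord //.
by rewrite nth_index ?mem_elts // -has_count has_pred1.
Qed.

Lemma elts_anticomm c d : c < 8 -> d < 8 -> 1 < c -> 1 < d -> c./2 != d./2 ->
  (nth 1 elts d * nth 1 elts c = x ^+ 2 * (nth 1 elts c * nth 1 elts d))%g.
Proof.
move=> c8 d8; rewrite !elts_xy // !mul_xy mulgA -expgD.
rewrite [LHS]xy_norm [RHS]xy_norm.
rewrite /xexp /yexp.
case: c c8 => [|[|[|[|[|[|[|[|c]]]]]]]] // _;
  case: d d8 => [|[|[|[|[|[|[|[|d]]]]]]]] // _ _ _ _.
all: by congr (_ * _)%g; exact: x_mod.
Qed.

Lemma axes_two v : 1 < axes v -> exists c d,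
  [/\ [/\ c < 8, d < 8, 1 < c, 1 < d & c./2 != d./2],
      0 < nth 0 (coords v) c & 0 < nth 0 (coords v) d].
Proof.
case: v => p1 pm pi pi' pj pj' pk pk'; rewrite /axes /= => ax.
have pick (c a b : nat) : 0 < a + b -> c < 4 ->
    nth 0 [:: p1; pm; pi; pi'; pj; pj'; pk; pk'] c.*2 = a ->
    nth 0 [:: p1; pm; pi; pi'; pj; pj'; pk; pk'] c.*2.+1 = b ->
    exists2 e, (e < 8) && (e./2 == c) &
      0 < nth 0 [:: p1; pm; pi; pi'; pj; pj'; pk; pk'] e.
  move=> ab c4 ha hb; have [a0|a0] := posnP a.
    by exists c.*2.+1; [lia | rewrite hb; lia].
  by exists c.*2; [lia | rewrite ha].
have [i0|i0] := posnP (pi + pi').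
  have [||||c /andP[c8 /eqP c2] cP] := pick 2 pj pj'; rewrite //; first by lia.
  have [||||d /andP[d8 /eqP d2] dP] := pick 3 pk pk'; rewrite //; first by lia.
  by exists c, d; split=> //; split=> //; lia.
have [||||c /andP[c8 /eqP c2] cP] := pick 1 pi pi'; rewrite //.
have [j0|j0] := posnP (pj + pj').
  have [||||d /andP[d8 /eqP d2] dP] := pick 3 pk pk'; rewrite //; first by lia.
  by exists c, d; split=> //; split=> //; lia.
have [||||d /andP[d8 /eqP d2] dP] := pick 2 pj pj'; rewrite //.
by exists c, d; split=> //; split=> //; lia.
Qed.

Lemma prod_parity s : parity (wcontent s) ->
  (\prod_(g <- s) g = 1 \/ \prod_(g <- s) g = x ^+ 2)%g.
Proof.
have [t] := prod_normal s; case: (wcontent s) => p1 pm pi pi' pj pj' pk pk' /=.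
set n := (_ + t.*2); set l := (pj + _ + _) => -> par.
have [n2 l2] : ~~ odd n /\ ~~ odd l by move: par; rewrite /parity /= /n /l; lia.
rewrite xy_norm (negbTE l2) mulg1.
have [d4|d4] := boolP (4 %| n + l./2.*2); first by left; apply/eqP; rewrite x_eq1.
by right; apply: x_mod; lia.
Qed.

(** The parity condition says that every ordering has product 1 or -1.  If two
    terms anticommute, exchanging them at the front of an ordering with
    product -1 yields one with product 1. *)
Lemma product_oneE S : product_one S <-> balanced (content S).
Proof.
split=> [[s sS s1]|/andP[par ab]].
  rewrite /content -(wcontent_perm sS) /balanced; apply/andP; split.
    have [t] := prod_normal s; rewrite s1 => /esym/eqP.
    by rewrite xy_eq1 /parity; case: (wcontent s) => /= *; lia.
  by case: ltnP => //= ax; rewrite -prod_abelian // s1.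
have [S1|Sm] := prod_parity par; first by exists S.
move: ab; case: ltnP => /= [/axes_two[c [d [[c8 d8 c1 d1 cd] cP dP]]] _|ax]; last first.
  by rewrite -prod_abelian // => /eqP S1; exists S.
set g := nth 1%g elts c; set h := nth 1%g elts d.
have gS : g \in enum_mset S by rewrite -has_pred1 has_count -wcontent_coord.
have hS : h \in enum_mset S by rewrite -has_pred1 has_count -wcontent_coord.
have gS_perm := perm_to_rem gS.
have hg : h != g by rewrite nth_uniq ?elts_uniq //; apply: contraNneq cd => ->.
have hr : h \in rem g S.
  by move: hS; rewrite (perm_mem gS_perm) inE (negbTE hg).
set r := rem h (rem g S).
have S_gh : perm_eq [:: g, h & r] S.
  by rewrite perm_sym (perm_trans gS_perm) // perm_cons perm_to_rem.
have S_hg : perm_eq [:: h, g & r] S.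
  by rewrite (perm_trans _ S_gh) // (perm_catCA [:: h] [:: g] r).
have [gh1|ghm] : (\prod_(k <- [:: g, h & r]) k = 1 \/
                  \prod_(k <- [:: g, h & r]) k = x ^+ 2)%g.
- by apply: prod_parity; rewrite (wcontent_perm S_gh).
- by exists [:: g, h & r].
exists [:: h, g & r] => //; apply/eqP; move: ghm; rewrite !big_cons => ghm.
by rewrite mulgA (elts_anticomm c8 d8) // -!mulgA ghm -!expgS x_eq1.
Qed.

Lemma split_content V S : vle V (content S) ->
  exists A B, [/\ content A = V, content B = vsub (content S) V & S = A `+` B].
Proof.
move=> leV; have [A AE] := content_surj V;
  have [B BE] := content_surj (vsub (content S) V).
by exists A, B; split=> //; apply: content_inj; rewrite contentD AE BE vsubK.
Qed.

Lemma content_eq0 S : (content S == vzero) = (S == mset0).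
Proof. by rewrite -content0 (inj_eq content_inj). Qed.

Lemma vsize_content_gt0 S : S != mset0 -> 0 < vsize (content S).
Proof. by rewrite lt0n vsize_eq0 content_eq0. Qed.

(** The list of atoms is complete since every non-empty product-one sequence
    has a member of the list as a removable part. *)
Lemma atomE A : atom A <-> content A \in atoms.
Proof.
split=> [atA|Ain].
  have [/product_oneE poA A0 natA] := atA.
  have : has (removable^~ (content A)) atoms.
    have [|/hasP[V Vin rV]|[]//] := pivot_or_short poA; first by rewrite content_eq0;
      exact/eqP.
    by apply/hasP; exists V => //; exact: (allP pivots_atoms).
  case/hasP => U Uin /andP[leU poU].
  have [B [C [BU CU AE]]] := split_content leU.
  have [U0 poB _] := and3P (allP atoms_vatom _ Uin).
  have [C0|/eqP C0] := eqVneq C mset0; first by rewrite AE C0 msetD0 BU.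
  case: natA; exists B, C; split=> //; first by apply/product_oneE; rewrite BU.
    by apply/product_oneE; rewrite CU.
  by apply/eqP; rewrite -content_eq0 BU.
have [A0 poA /vallP irrA] := and3P (allP atoms_vatom _ Ain).
split; [exact/product_oneE | by apply/eqP; rewrite -content_eq0 |].
case=> B [C [/product_oneE poB /product_oneE poC /eqP B0 /eqP C0 AE]].
have leBA : vle (content B) (content A) by rewrite AE contentD vle_add.
have := irrA _ leBA; rewrite {2}AE contentD vaddK poB poC content_eq0 (negbTE B0).
rewrite /= orbF (inj_eq content_inj) AE => /eqP/(congr1 (fun D => size (enum_mset D))).
rewrite size_msetD => /eqP; rewrite -{1}(addn0 (size B)) eqn_add2l eq_sym.
by rewrite size_mset_eq0 (negbTE C0).
Qed.
Opaque atoms atoms_with pivots.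
Arguments content _ : simpl never.
Arguments vadd : simpl never.
Arguments vsub : simpl never.
Arguments vsize : simpl never.

(** * Catenary degrees are at most 4 *)

Lemma content_sum (l : seq {mset gT}) :
  content (\big[@msetD gT/mset0]_(A <- l) A) = \big[vadd/vzero]_(A <- l) content A.
Proof. by apply: (big_morph content contentD content0). Qed.

Lemma factorizations_balanced S z A : factorizations S z -> A \in z ->
  balanced (content A).
Proof. by case=> zat _ /zat[/product_oneE]. Qed.

(** The terms of [T] lie in a cyclic subgroup of order 4 and have product -1.
    Atoms inside this subgroup do not change this, so one of the atoms of [l]
    leaves it, and this atom alone makes [T] balanced. *)
Lemma balanced_extend_sum T (l : seq {mset gT}) : parity T -> 0 < axes T ->
  ~~ balanced T ->
  (forall A, A \in l -> balanced (content A)) ->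
  balanced (vadd T (content (\big[@msetD gT/mset0]_(A <- l) A))) ->
  exists2 A, A \in l & balanced (vadd T (content A)).
Proof.
elim: l T => [|A l IHl] T pT aT npT pol.
  by rewrite big_nil content0 vadd0 (negbTE npT).
rewrite big_cons contentD vaddA => poTl.
have poA : balanced (content A) by apply: pol; rewrite mem_head.
have [poTA|npTA] := boolP (balanced (vadd T (content A))); first by exists A;
  rewrite ?mem_head.
have [|||||B Bl poB] := IHl (vadd T (content A)); rewrite ?npTA //.
- by rewrite parityD //; case/andP: poA.
- by apply: leq_trans aT _; exact: axesD.
- by move=> B Bl; apply: pol; rewrite inE Bl orbT.
exists B; first by rewrite inE Bl orbT.
by apply: balanced_extend poB => //; apply: pol; rewrite inE Bl orbT.
Qed.

Lemma mem_big_msetD (l : seq {mset gT}) g :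
  g \in \big[@msetD gT/mset0]_(A <- l) A -> exists2 A : {mset gT}, A \in l & g \in A.
Proof.
elim: l => [|A l IHl]; first by rewrite big_nil in_mset0.
rewrite big_cons in_msetD => /orP[gA|/IHl[B Bl gB]]; first by exists A;
  rewrite ?mem_head.
by exists B; rewrite // inE Bl orbT.
Qed.

Lemma factorizations_coord S z c : factorizations S z -> c < 8 ->
  0 < nth 0 (coords (content S)) c ->
  exists2 A, A \in z & content A \in nth [::] atoms_with c.
Proof.
move=> [zat <-] c8; rewrite content_coord // -in_mset => Sc.
have [A Az Ac] := mem_big_msetD Sc.
exists A => //; have Ain : content A \in atoms by apply/atomE/zat.
by rewrite atoms_withP // content_coord // -in_mset Ac.
Qed.

(** As long as the atoms in [u] do not suffice to remove [V], the remaining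
    atoms [w] contain one of the candidates. *)
Lemma extensionsP V S u w : factorizations S (u `+` w) ->
  removable V (content S) -> ~~ removable V (content (msum u)) ->
  vle V (content (msum u)) ==> (0 < axes (vsub (content (msum u)) V)) ->
  exists2 A, A \in w & content A \in extensions V (content (msum u)).
Proof.
move=> Suw /andP[leVS poSV]; have [_ ww SE] := factorizations_split Suw.
rewrite /removable /extensions; set s := content (msum u).
have sE : content S = vadd s (content (msum w)) by rewrite SE contentD.
have [leVs|nle _ _] := boolP (vle V s); rewrite ?leVs ?(negbTE nle) /=.
  move=> npT aT.
  have SVE : vsub (content S) V = vadd (vsub s V) (content (msum w)).
    by rewrite sE -{1}(vsubK leVs) -vaddA vaddK.
  have poww : balanced (content (msum w)) by
    apply/product_oneE/factorizations_product_one/ww.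
  have pT : parity (vsub s V).
    case/andP: poSV => + _; rewrite SVE vaddC parityD //.
    by case/andP: poww.
  have [||A Aw poA] := @balanced_extend_sum (vsub s V) w pT aT npT.
  - by move=> A; exact: factorizations_balanced ww.
  - by rewrite -SVE.
  exists A => //; rewrite mem_filter poA; apply/atomE.
  by case: ww => + _; exact.
have [c8 ltc] := missingP nle.
apply: factorizations_coord ww c8 _; have := vle_coord (missing V s) leVS.
by rewrite sE coordsD; move: ltc; lia.
Qed.

(** The computation [search] is run along the given factorization [u + w]: it
    always takes the next atom from [w], and a pivot from [early] which is
    removable from a part of [S] would be removable from [S]. *)
Lemma searchP V early k S u w : factorizations S (u `+` w) ->
  removable V (content S) ->
  (forall W, W \in early -> ~~ removable W (content S)) ->
  search V early k (content (msum u)) ->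
  exists u' w', [/\ u `+` w = u' `+` w', size u' <= size u + k,
    removable V (content (msum u')) & exchangeable V (content (msum u'))].
Proof.
move=> + VS earlyS; elim: k u w => [|k IHk] u w Suw /=.
all: have [_ ww SE] := factorizations_split Suw.
all: case: hasP => [[W Wearly /andP[leW poW]]|_].
1,3: have /negP[] := earlyS W Wearly; rewrite SE contentD /removable.
1,2: rewrite -(vsubK leW) -vaddA vle_add vaddK balancedD //.
1,2: by apply/product_oneE/factorizations_product_one/ww.
all: case: ifPn => [Vu exV|nVu]; first by exists u, w; rewrite leq_addr.
  by [].
case/andP=> ext /allP allk.
have [A /mset_split[w' wE] /allk] := extensionsP Suw VS nVu ext.
rewrite -contentD -{1}(msum1 A) -msumD => /IHk -/(_ w').
rewrite -msetDA -wE => /(_ Suw)[u' [w'' [uwE sz rV eV]]].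
exists u', w''; split=> //.
by rewrite (leq_trans sz) // size_msetD size_mset1 addn1 addSnnS.
Qed.

Lemma vsize_factorizations S z : factorizations S z -> n1 (content S) = 0 ->
  (size z).*2 <= vsize (content S).
Proof.
case=> zat zS; rewrite -zS !content_sum.
rewrite (big_morph n1 (id1 := 0) (op1 := addn)) //; last by case=> ? ? ? ? ? ? ? ? [].
move/eqP; rewrite sum_nat_seq_eq0 => /allP n0.
rewrite (big_morph vsize (id1 := 0) (op1 := addn) vsizeD) //.
rewrite -muln2 mulnC -sum1_size big_distrr /= [leqLHS]big_seq [leqRHS]big_seq.
apply: leq_sum => A Az; rewrite muln1.
have /atomE/(allP atoms_big) := zat A Az.
by have /= /eqP-> := n0 A Az.
Qed.

Lemma size_factorizations n S z : factorizations S z -> n1 (content S) = 0 ->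
  vsize (content S) <= n.*2.+1 -> size z <= n.
Proof. by move=> Sz /(vsize_factorizations Sz) le /(leq_trans le);
  rewrite leq_Sdouble. Qed.

Lemma shortP n S : product_one S -> short n (content S) ->
  exists2 z, factorizations S z & size z <= n.
Proof.
elim: n S => [|n IHn] S poS /=; case: leqP => [leS /eqP S0|_].
- have [z Sz] := factorizations_exists poS; exists z => //.
  exact: size_factorizations leS.
- by [].
- have [z Sz] := factorizations_exists poS; exists z => //.
  exact: size_factorizations leS.
case/hasP => U; rewrite mem_rev => Uin /andP[/andP[leU poU]].
have [A [B [AU BU SE]]] := split_content leU.
rewrite -BU => /IHn[|z Bz sz]; first by apply/product_oneE; rewrite BU.
have atA : atom A by apply/atomE; rewrite AU.
exists ([mset A] `+` z); first by rewrite SE;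
  exact: factorizationsD (factorizations1 atA) Bz.
by rewrite size_msetD size_mset1.
Qed.

Lemma vsize_content_lt A B : A != mset0 ->
  vsize (content B) < vsize (content (A `+` B)).
Proof.
by move/vsize_content_gt0 => A0; rewrite contentD vsizeD addnC -addn1 leq_add2l.
Qed.

(** The hypothesis on [T] is the induction hypothesis of [joined4]; it is
    needed for the products of atoms which do not contain [V] together with at
    most three other atoms, and are treated through another pivot. *)
Lemma pivot_reach i S A B z : i < size pivots ->
  content A = nth vzero pivots i -> S = A `+` B -> product_one B ->
  (forall W, W \in take i pivots -> ~~ removable W (content S)) ->
  (forall T z z', vsize (content T) < vsize (content S) ->
     factorizations T z -> factorizations T z' -> joined T (Some 4) z z') ->
  factorizations S z ->
  exists2 u, factorizations B u & joined S (Some 4) z ([mset A] `+` u).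
Proof.
move=> i_lt AV SE poB early IH Sz; set V := nth vzero pivots i in AV.
have atA : atom A by apply/atomE; rewrite AV; exact/(allP pivots_atoms)/mem_nth.
have rV : removable V (content S).
  by rewrite /removable SE contentD AV vle_add vaddK; apply/product_oneE.
have searchV : search V (take i pivots) 4 (content (msum mset0)).
  rewrite msum0 content0; apply: (allP search_all_pivots i).
  by rewrite mem_iota.
have Sz0 : factorizations S (mset0 `+` z) by rewrite mset0D.
have [u [w [+ szu /andP[leVu poVu] ex]]] := searchP Sz0 rV early searchV.
rewrite mset0D => zE; rewrite zE in Sz *; rewrite size_mset0 add0n in szu.
have [uu ww SE'] := factorizations_split Sz.
case/orP: ex =>
  [shortC|/hasP[K Kin /and3P[/andP[leK poK] shortC /andP[leVC balancedD]]]].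
  have [A' [C [A'V CE uE]]] := split_content leVu.
  have A'A : A' = A by apply: content_inj; rewrite AV.
  rewrite A'A in uE.
  have poC : product_one C by apply/product_oneE; rewrite CE.
  rewrite -CE in shortC; have [f Cf szf] := shortP poC shortC.
  exists (f `+` w).
    have -> : B = C `+` msum w.
      by apply: (@msetD_inj _ A); rewrite -SE SE' uE -msetDA.
    exact: factorizationsD.
  rewrite msetDA; apply: joined_exchange => //; last by rewrite size_msetD size_mset1.
  by rewrite uE; apply: factorizationsD => //; exact: factorizations1.
have [A_K [C [AK CE uE]]] := split_content leK.
rewrite -CE in shortC leVC balancedD poK;
  have poC : product_one C by apply/product_oneE.
have [f Cf szf] := shortP poC shortC.
have [A' [D [A'V DE CE']]] := split_content leVC.
have A'A : A' = A by apply: content_inj; rewrite AV.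
rewrite A'A in CE'.
have atK : atom A_K by apply/atomE; rewrite AK; exact: (allP pivots_atoms).
have poDw : product_one (D `+` msum w).
  apply: product_oneD; last exact: factorizations_product_one ww.
  by apply/product_oneE; rewrite DE.
have [g Dg] := factorizations_exists poDw.
have SK : S = A_K `+` (C `+` msum w) by rewrite SE' uE msetDA.
(* Through K: first K is split off from the collected atoms, and then the
   induction hypothesis for the rest of S produces A. *)
exists ([mset A_K] `+` g).
  have -> : B = A_K `+` (D `+` msum w).
    by apply: (@msetD_inj _ A); rewrite -SE SK CE' -msetDA msetDCA.
  by apply: factorizationsD => //; exact: factorizations1.
apply: (@joined_trans _ _ _ _ ([mset A_K] `+` f `+` w)).
  apply: joined_exchange => //; last by rewrite size_msetD size_mset1.
  by rewrite uE; apply: factorizationsD => //; exact: factorizations1.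
rewrite msetDCA -msetDA [X in joined X]SK ![[mset A_K] `+` _]msetDC (msetDC A_K).
apply: joined_add; first exact: factorizations1.
apply: IH.
- by rewrite SK; exact/vsize_content_lt/atom_neq0.
- exact: factorizationsD.
- rewrite CE' -msetDA; apply: factorizationsD => //; exact: factorizations1.
Qed.

Lemma joined4 S z z' : factorizations S z -> factorizations S z' ->
  joined S (Some 4) z z'.
Proof.
have [n] := ubnP (vsize (content S)); elim: n S z z' => // n IHn S z z'.
rewrite ltnS => leSn Sz Sz'.
have [S0|S0] := eqVneq S mset0.
  rewrite S0 in Sz Sz'; rewrite (factorizations_of0 Sz) (factorizations_of0 Sz').
  exact: joined_refl.
have /product_oneE poS := factorizations_product_one Sz.
have [|has_pivot|[S1 S9 _]] := pivot_or_short poS; first by rewrite content_eq0.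
  have i_lt := has_pivot; rewrite has_find in i_lt.
  have := nth_find vzero has_pivot.
  set i := find _ _ in i_lt * => /andP[leV poB].
  have [A [B [AV BE SE]]] := split_content leV.
  have poB' : product_one B by apply/product_oneE; rewrite BE.
  have early W : W \in take i pivots -> ~~ removable W (content S).
    case/(nthP vzero) => j; rewrite size_take i_lt => ji <-.
    by rewrite nth_take // (before_find vzero ji).
  have IH T t t' : vsize (content T) < vsize (content S) ->
      factorizations T t -> factorizations T t' -> joined T (Some 4) t t'.
    by move=> ltT; apply: IHn; exact: leq_trans ltT leSn.
  have [u Bu zu] := pivot_reach i_lt AV SE poB' early IH Sz.
  have [u' Bu' zu'] := pivot_reach i_lt AV SE poB' early IH Sz'.
  apply: joined_trans zu _; apply: joined_trans (joined_sym Sz' zu').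
  have atA : atom A by apply/atomE; rewrite AV; exact/(allP pivots_atoms)/mem_nth.
  rewrite SE ![[mset A] `+` _]msetDC (msetDC A).
  apply: joined_add; first exact: factorizations1.
  apply: IH => //; rewrite SE; exact/vsize_content_lt/atom_neq0.
apply: joined_step => //; apply: leq_trans (fdist_leq _ _) _.
rewrite geq_max; apply/andP.
by split; [exact: (@size_factorizations 4 S z) | exact: (@size_factorizations 4 S z')].
Qed.

(** * Sets of lengths *)

Lemma vlengthsP n S l : vsize (content S) <= n ->
  lengths S l <-> l \in vlengths n (content S).
Proof.
elim: n S l => [|n IHn] S l leS /=.
all: have [S0|S0] := eqVneq (content S) vzero.
1,3: have {}S0 : S = mset0 by apply/eqP; rewrite -content_eq0 S0.
1,2: rewrite inE S0; split=> [[z /factorizations_of0-> <-]|/eqP->].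
1,3: by rewrite size_mset0.
1,2: by exists mset0; [exact: factorizations0 | rewrite size_mset0].
- by move: leS; rewrite leqn0 vsize_eq0 (negbTE S0).
have nle : ~~ vle (content S) vzero.
  by apply: contraNN S0 => /vle0->.
have [c8 cP] := missingP nle; split.
  case=> z Sz <-; have [|A Az Ac] := factorizations_coord Sz c8;
    first exact: leq_ltn_trans cP.
  have [w zE] := mset_split Az; rewrite zE in Sz *.
  have [Aw ww SE] := factorizations_split Sz; rewrite msum1 in Aw SE.
  have A0 : A != mset0 by apply: atom_neq0; case: Sz => + _; apply; exact: mset1D1.
  apply/flattenP; exists [seq l.+1 | l <- vlengths n (content (msum w))].
    apply/mapP; exists (content A); last by rewrite SE contentD vaddK.
    by rewrite mem_filter Ac SE contentD vle_add.
  rewrite size_msetD size_mset1 add1n map_f //; apply/IHn; last by exists w.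
  by rewrite -ltnS (leq_trans _ leS) // SE vsize_content_lt.
case/flattenP=> _ /mapP[U + ->] /mapP[l' l'in ->].
rewrite mem_filter atoms_withP // => /andP[leU /andP[_ Uin]].
have [A [B [AU BU SE]]] := split_content leU.
have atA : atom A by apply/atomE; rewrite AU.
rewrite -BU in l'in; case/IHn: l'in => [|z Bz <-].
  by rewrite -ltnS (leq_trans _ leS) // SE vsize_content_lt // atom_neq0.
exists ([mset A] `+` z); last by rewrite size_msetD size_mset1.
by rewrite SE; apply: factorizationsD => //; exact: factorizations1.
Qed.

Lemma lengths_pair v a b : (let L := vlengths (vsize v) v in
    [&& a \in L, b \in L & all (fun l => (l == a) || (l == b)) L]) ->
  forall S, content S = v -> lengths S = [set a; b].
Proof.
case/and3P=> La Lb /allP Lab S Sv; apply/seteqP; split=> l.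
  by move/(vlengthsP l (leqnn _)); rewrite Sv => /Lab/orP[]/eqP; [left | right].
by case=> /= ->; apply/(vlengthsP _ (leqnn _)); rewrite Sv.
Qed.

Lemma distances_le2 d : distances gT d -> 1 <= d <= 2.
Proof.
case=> S _ [d0 [l]] Sl Ld; rewrite d0 /=.
have gap m : lengths S m -> m <= l \/ l + d <= m.
  move=> Sm; have [|lm] := leqP m l; first by left.
  right; rewrite leqNgt; apply/negP => md.
  have : [set l; l + d] m.
    by rewrite -Ld; split; [exact: Sm | apply/andP; split; exact: ltnW].
  by case=> mE; move: lm md; rewrite mE ltnn.
have [z Sz zl] := Sl.
have [z' Sz' z'l] : lengths S (l + d).
  have : [set l; l + d] (l + d) by right.
  by rewrite -Ld => -[].
have := joined_gap Sz (joined4 Sz Sz') gap;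
  rewrite zl z'l => /(_ (leqnn _) d0 (leqnn _)).
by rewrite addn2 !ltnS.
Qed.

Lemma daleth_star_bounds d : daleth_star gT d -> 3 <= d <= 4.
Proof.
case=> S [_ S2 L2 [[Sd /eqP d2] mind]].
have := lengths_ge2 S2 Sd; rewrite leq_eqVlt eq_sym (negbTE d2) /= => ->.
have [z Sz z2] := S2; have [z' Sz' z'd] := Sd.
have [l Sl /andP[l2 l4]] : exists2 l, lengths S l & (l != 2) && (l <= 4).
  by apply: (joined_leave Sz (joined4 Sz Sz')) => //; rewrite z'd; exact/eqP.
by apply: leq_trans (mind l _) l4; split=> //; exact/eqP.
Qed.

Lemma catenary_degrees_bounds N : catenary_degrees gT N ->
  exists2 n, 2 <= n <= 4 & Some n = N.
Proof.
case=> S [_ [_ minN] N2].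
have := minN (Some 4) (@joined4 S).
by case: N N2 {minN} => //= n n2 n4; exists n; rewrite ?n2.
Qed.

(** [i^2 (-i)^2 j^2 (-j)^2 = (i i j j) (-i -i -j -j) = (i -i)^2 (j -j)^2]. *)
Lemma lengths_24 : exists S, lengths S = [set 2; 4].
Proof.
have [S Sv] := content_surj (Vec 0 0 2 2 2 2 0 0); exists S.
by apply: lengths_pair Sv; lazy.
Qed.

(** [(-1 i i) (-1 -i -i) = (-1 -1) (i -i)^2]. *)
Lemma lengths_23 : exists S, lengths S = [set 2; 3].
Proof.
have [S Sv] := content_surj (Vec 0 2 2 2 0 0 0 0); exists S.
by apply: lengths_pair Sv; lazy.
Qed.

(** [(i j k) (i j -k) = (i i j j) (k -k)]. *)
Lemma catenary_degree_2 : exists S, product_one S /\ catenary_degree S (Some 2).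
Proof.
have atomV v : v \in atoms -> exists2 A, atom A & content A = v.
  by move=> vat; have [A AE] := content_surj v; exists A; rewrite // atomE AE.
have [A atA AE] := atomV (Vec 0 0 1 0 1 0 1 0) isT.
have [B atB BE] := atomV (Vec 0 0 1 0 1 0 0 1) isT.
have [C atC CE] := atomV (Vec 0 0 2 0 2 0 0 0) isT.
have [D atD DE] := atomV (Vec 0 0 0 0 0 0 1 1) isT.
have CD : C `+` D = A `+` B by apply: content_inj; rewrite !contentD AE BE CE DE.
have AB := factorizationsD (factorizations1 atA) (factorizations1 atB).
have CD' := factorizationsD (factorizations1 atC) (factorizations1 atD).
rewrite CD in CD'; exists (A `+` B); split; first exact: factorizations_product_one AB.
apply: catenary_degree_unique_length AB CD' _.
  rewrite -[RHS]setUid; apply: lengths_pair; last by rewrite contentD AE BE.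
  by lazy.
move=> ABCD; have : A \in [mset C] `+` [mset D] by rewrite -ABCD mset1D1.
by rewrite in_msetD !in_mset1 -!(inj_eq content_inj) AE CE DE.
Qed.

End Quaternion.

Lemma Q8_generators (gT : finGroupType) : [set: gT]%G \isog 'Q_8%G ->
  exists x y : gT, [/\ #[x]%g = 4, (y ^+ 2 = x ^+ 2)%g, (y * x = x ^+ 3 * y)%g,
    y \notin <[x]>%g & #|gT| = 8].
Proof.
move=> hG; have [//|[x y]] := @generators_quaternion _ [set: gT]%G 3 _ hG.
case=> /= o8 _ ox + [_ yy xy]; rewrite inE => /andP[yX _].
exists x, y; split=> //; last by rewrite -cardsT.
by rewrite -{1}(invgK x) -xy -conjVg -conjgC invg_expg ox.
Qed.

Theorem theorem4p4 (gT : finGroupType) (hG : [set: gT]%G \isog 'Q_8%G) :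
  [/\ catenary_degrees gT = Some @` interval 2 4,
      daleth_star gT = interval 3 4 &
      distances gT = interval 1 2].
Proof.
have [x [y [ox yy yx yX cT]]] := Q8_generators hG.
have [S24 L24] := lengths_24 ox yy yx yX cT.
have [S23 L23] := lengths_23 ox yy yx yX cT.
have [S2 [po2 c2]] := catenary_degree_2 ox yy yx yX cT.
have po_of S : lengths S 2 -> product_one S.
  by case=> z Sz _; exact: factorizations_product_one Sz.
split; apply/seteqP; split.
- by move=> N /(catenary_degrees_bounds ox yy yx yX cT)[n n24 <-]; exists n.
- move=> _ [n /andP[n2 n4] <-]; case: n n2 n4 => [|[|[|[|[|n]]]]] // _ _.
  + by exists S2.
  + exists S23; split=> //; first by apply: po_of; rewrite L23; left.
    exact: catenary_degree_two_lengths.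
  + exists S24; split=> //; first by apply: po_of; rewrite L24; left.
    exact: catenary_degree_two_lengths.
- exact: (daleth_star_bounds ox yy yx yX cT).
- move=> [|[|[|[|[|d]]]]] // _; [exact: daleth_star_two_lengths L23 |].
  exact: daleth_star_two_lengths L24.
- exact: (distances_le2 ox yy yx yX cT).
- move=> [|[|[|d]]] // _; [exact: distances_two_lengths L23 |].
  exact: distances_two_lengths L24.
Qed.
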